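(* Let $t>0$ and let $\lambda_0^t:\Omega\to\mathbb{R}$ be the largest eigenvalue of the Cauchy-Green deformation tensor of the flow from time $0$ to time $t$. Suppose $\mathcal{M}$ is a $\lambda_0^t$-ridge, and put $m=\min_{\mathbf{x}\in\mathcal{M}}\sqrt{\lambda_0^t(\mathbf{x})}>0$, where $m>1$ so that $m$ is an admissible separation factor. If there exists a tubular neighbourhood $\Gamma_{\mathcal{M}}(\rho)$ of $\mathcal{M}$ such that 1. for any fixed $\mathbf{y}\in\Gamma_{\mathcal{M}}(\rho)$, the quantity $\lambda_0^{\tau}(\mathbf{y})$ is increasing in $\tau\in[0,t]$, and 2. $\{\mathbf{x}\in\Gamma_{\mathcal{M}}(\rho):\lambda_0^t(\mathbf{x})\ge m^2\}=\mathcal{M}$, then $\mathcal{M}$ is also a $\gamma_m$-ridge, i.e. a ridge of the infinitesimal size Lyapunov exponent (ISLE) function $\mathbf{x}\mapsto\gamma_m(\mathbf{x},0)$ with separation factor $m$.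
   Context: Flow. Let $\Omega\subset\mathbb{R}^d$ be a bounded domain and $\mathbf{u}:\Omega\times\mathbb{R}\to\mathbb{R}^d$ a (time dependent) Lipschitz velocity field. Consider the ODE $\mathbf{x}'(t)=\mathbf{u}(\mathbf{x}(t),t)$. The flow map $\Phi_a^b$ sends $\mathbf{x}_0\in\Omega$ to $\Phi_a^b(\mathbf{x}_0)=\mathbf{x}(b)$, where $\mathbf{x}$ is the solution with $\mathbf{x}(a)=\mathbf{x}_0$. Solutions are taken to exist for all initial points in $\Omega$ and all times considered, and each $\Phi_a^b$ is taken to be differentiable in the spatial variable, so that its Jacobian is defined. Cauchy-Green tensor. $C_0^\tau(\mathbf{x})=[\nabla\Phi_0^\tau(\mathbf{x})]^*\,\nabla\Phi_0^\tau(\mathbf{x})$ (where $^*$ is the transpose), and $\lambda_0^\tau(\mathbf{x})=\lambda_{\max}(C_0^\tau(\mathbf{x}))$ is its largest eigenvalue. ISLE. For a separation factor $r>1$ and the time window $[0,t]$, if $\sqrt{\lambda_0^\tau(\mathbf{x})}=r$ for some $\tau\in[0,t]$, let $\tau_r(\mathbf{x})$ be the shortest such time and set $\gamma_r(\mathbf{x},0)=\frac{\ln r}{|\tau_r(\mathbf{x})|}$. By convention $\gamma_r(\mathbf{x},0)=0$ if $\sqrt{\lambda_0^s(\mathbf{x})}<r$ for all $s\in[0,t]$. Ridge. For a scalar function $f$ on $\Omega$, an $f$-ridge is a codimension-one, compact, $C^1$ surface (possibly with boundary) $\mathcal{M}\subset\Omega$ such that for every $\mathbf{x}\in\mathcal{M}$,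 $f(\mathbf{x})$ is a local maximum of $f$ along the normal direction to $\mathcal{M}$ at $\mathbf{x}$; that is, with $\mathbf{n}_{\mathbf{x}}$ a unit normal to $\mathcal{M}$ at $\mathbf{x}$, there is $\delta>0$ such that $f(\mathbf{x}+s\,\mathbf{n}_{\mathbf{x}})\le f(\mathbf{x})$ for all $|s|<\delta$. Tubular neighbourhood. For a codimension-one, compact, smooth surface $\mathcal{S}$ and $\rho>0$, $\Gamma_{\mathcal{S}}(\rho)$ is the collection of points $\mathbf{y}$ that can be uniquely expressed as $\mathbf{y}=\mathbf{x}+s\,\mathbf{n}_{\mathbf{x}}$ with $\mathbf{x}\in\mathcal{S}$, $s\in(-\rho,\rho)$ and $\mathbf{n}_{\mathbf{x}}$ a unit normal vector of $\mathcal{S}$ at $\mathbf{x}$ (uniqueness up to replacing $(s,\mathbf{n}_{\mathbf{x}})$ by $(-s,-\mathbf{n}_{\mathbf{x}})$). It is understood that $\rho$ is small enough that every point $\mathbf{x}+s\,\mathbf{n}_{\mathbf{x}}$ with $\mathbf{x}\in\mathcal{S}$, $|s|<\rho$, lies in $\Omega$ and has such a unique expression. Whenever a tubular neighbourhood of a ridge is considered, the ridge is assumed to be smooth, as this definition requires. *)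

(* Defs.v *)
From mathcomp Require Import all_boot all_order all_algebra.
From mathcomp Require Import all_classical all_reals all_analysis.
Set Implicit Arguments.
Unset Strict Implicit.
Unset Printing Implicit Defensive.
Import Order.TTheory GRing.Theory Num.Theory.
Import numFieldNormedType.Exports.
Local Open Scope classical_set_scope.
Local Open Scope ring_scope.

(* Points of R^d (d >= 1) are row vectors 'rV[R]_n.+1 with d = n.+1.  The library
   norm on this type is the sup norm; it is used only for topological notions
   (continuity, differentiability, boundedness, Lipschitz), where the choice of
   norm is immaterial.  Unit normals are unit vectors for the Euclidean product. *)

Section Flow.
Context {R : realType} {n : nat}.
Local Notation V := 'rV[R]_n.+1.

Definition is_domain (Omega : set V) : Prop :=
  [/\ open Omega, connected Omega, Omega !=set0 & bounded_set Omega].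

(* The one-sided derivatives at a and b exist and satisfy the equation as well,
   by continuity of x and u. *)
Definition is_solution (Omega : set V) (u : V -> R -> V) (a b : R)
    (x : R -> V) : Prop :=
  [/\ {within `[a, b], continuous x},
      forall s, s \in `[a, b] -> Omega (x s) &
      forall s, s \in `]a, b[ -> is_derive s 1 x (u (x s) s)].

(* Phi s stands for the flow map Phi_a^s, for a <= s <= b. *)
Definition is_flow (Omega : set V) (u : V -> R -> V) (a b : R)
    (Phi : R -> V -> V) : Prop :=
  forall x0, Omega x0 ->
    Phi a x0 = x0 /\ is_solution Omega u a b (fun s => Phi s x0).

(* The library's 'J acts on row vectors from the right, so it is the transpose
   of the usual Jacobian matrix. *)
Definition jac (f : V -> V) (x : V) : 'M[R]_n.+1 := ('J f x)^T.

Definition cauchy_green (Phi : R -> V -> V) (tau : R) (x : V) : 'M[R]_n.+1 :=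
  (jac (Phi tau) x)^T *m jac (Phi tau) x.

(* For a symmetric matrix the set of real eigenvalues is finite and nonempty, so
   that the supremum is a maximum. *)
Definition lambda_max (A : 'M[R]_n.+1) : R := sup [set a | eigenvalue A a].

Definition lambda (Phi : R -> V -> V) (tau : R) (x : V) : R :=
  lambda_max (cauchy_green Phi tau x).

Definition hitting_times (Phi : R -> V -> V) (t r : R) (x : V) : set R :=
  [set tau | 0 <= tau <= t /\ Num.sqrt (lambda Phi tau x) = r].

(* For x in Omega, lambda Phi ^~ x is continuous on [0, t] because u is Lipschitz,
   and it equals 1 at time 0.  So a nonempty set of hitting times has a least
   element, its infimum, and for r > 1 the set is empty exactly when
   sqrt (lambda Phi s x) < r for all s in [0, t]. *)
Definition isle (Phi : R -> V -> V) (t r : R) (x : V) : R :=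
  if `[< hitting_times Phi t r x !=set0 >]
  then ln r / `|inf (hitting_times Phi t r x)| else 0.

End Flow.

Section Surfaces.
Context {R : realType} {n : nat}.
Local Notation V := 'rV[R]_n.+1.

Definition dotmul (v w : V) : R := \sum_i v 0 i * w 0 i.

Definition grad (g : V -> R) (x : V) : V := \row_i 'D_(delta_mx 0 i) g x.

Fixpoint class_C (k : nat) (U : set V) (g : V -> R) : Prop :=
  (forall x, U x -> {for x, continuous g}) /\
  (if k is k'.+1 then
     (forall x, U x -> differentiable g x) /\
     (forall i, class_C k' U (fun x => grad g x 0 i))
   else True).

Definition class_Cinfty (U : set V) (g : V -> R) : Prop :=
  forall k, class_C k U g.

(* g is a local equation of M on the open set U: near an interior point M is the
   regular zero set of g, near a boundary point it is the part h >= 0 of this zero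
   set, where g and h have independent gradients. The parameter reg is the
   regularity class of the surface. *)
Definition local_equation (reg : set V -> (V -> R) -> Prop) (M U : set V)
    (g : V -> R) : Prop :=
  [/\ open U, reg U g, forall y, U y -> grad g y != 0 &
      M `&` U = [set y | U y /\ g y = 0] \/
      exists h : V -> R,
        [/\ reg U h,
            forall y, U y -> row_free (col_mx (grad g y) (grad h y)) &
            M `&` U = [set y | [/\ U y, g y = 0 & 0 <= h y]]]].

Definition is_hypersurface (reg : set V -> (V -> R) -> Prop) (M : set V) : Prop :=
  forall x, M x -> exists U g, U x /\ local_equation reg M U g.

(* At x in M, the line spanned by grad g x is the orthogonal complement of the
   tangent space of M at x, hence does not depend on the local equation g. *)
Definition unit_normal (M : set V) (x v : V) : Prop :=
  dotmul v v = 1 /\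
  exists U g, [/\ U x, local_equation (class_C 1) M U g &
                  exists c : R, v = c *: grad g x].

Definition is_ridge (Omega : set V) (f : V -> R) (M : set V) : Prop :=
  [/\ M `<=` Omega, compact M, is_hypersurface (class_C 1) M &
      forall x v, M x -> unit_normal M x v ->
        exists2 delta : R, 0 < delta &
          forall s : R, `|s| < delta -> f (x + s *: v) <= f x].

Definition tube_expr (S : set V) (rho : R) (y x : V) (s : R) (v : V) : Prop :=
  [/\ S x, unit_normal S x v, `|s| < rho & y = x + s *: v].

Definition tube (S : set V) (rho : R) : set V :=
  [set y | (exists x s v, tube_expr S rho y x s v) /\
     forall x s v x' s' v',
       tube_expr S rho y x s v -> tube_expr S rho y x' s' v' ->
       x = x' /\ ((s = s' /\ v = v') \/ (s = - s' /\ v = - v'))].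

Definition tube_radius (Omega S : set V) (rho : R) : Prop :=
  0 < rho /\
  forall x s v, S x -> unit_normal S x v -> `|s| < rho ->
    Omega (x + s *: v) /\ tube S rho (x + s *: v).

End Surfaces.

(* Main.v *)
Require Import Defs.
From mathcomp Require Import all_boot all_order all_algebra.
From mathcomp Require Import all_classical all_reals all_analysis.
Set Implicit Arguments.
Unset Strict Implicit.
Unset Printing Implicit Defensive.
Import Order.TTheory GRing.Theory Num.Theory.
Import numFieldNormedType.Exports.
Local Open Scope classical_set_scope.
Local Open Scope ring_scope.

(** The two facts behind the theorem are that the ISLE is nonnegative
    everywhere and that it vanishes on the punctured normal segments of [M].
    A point [x + s *: v] with [s != 0] on a normal segment of the tube cannot
    lie on [M]: it would have the second normal expression based at itself, with
    [s = 0] ([normal_segment_meets_surface_once]).  Being in the tube and not on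
    [M], it has [lambda Phi t] below [m ^+ 2] by the superlevel hypothesis, and
    monotonicity in time keeps the stretching [Num.sqrt (lambda Phi tau)] below
    [m] on the whole window [[0, t]].  The separation factor is therefore never
    reached and the ISLE is zero there ([isle_eq0]), hence at most its
    nonnegative value at [x] ([isle_ge0]).  So the whole segment of
    half-length [rho] witnesses the local maximum; the smoothness and compactness
    required of a ridge do not involve the scalar function and carry over. *)

Section Normals.
Context {R : realType} {n : nat}.
Local Notation V := 'rV[R]_n.+1.

Lemma dotmul_self_gt0 (w : V) : w != 0 -> 0 < dotmul w w.
Proof.
move=> w0; have sq_ge0 i : 0 <= w 0 i * w 0 i by rewrite -expr2 sqr_ge0.
rewrite lt_neqAle sumr_ge0 ?andbT//.
apply: contra_neqN w0 => /eqP /esym dot0; apply/rowP => i; rewrite mxE.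
have /eqP := psumr_eq0P (fun j (_ : xpredT j) => sq_ge0 j) dot0 (i := i) isT.
by rewrite mulf_eq0 orbb => /eqP.
Qed.

Lemma dotmulZ (c : R) (w : V) :
  dotmul (c *: w) (c *: w) = c ^+ 2 * dotmul w w.
Proof.
by rewrite /dotmul mulr_sumr; apply: eq_bigr => i _; rewrite !mxE mulrACA.
Qed.

(** The gradient of a local equation does not vanish, so it can be normalised. *)
Lemma unit_normal_exists (M : set V) (x : V) :
  is_hypersurface (class_C 1) M -> M x -> exists v, unit_normal M x v.
Proof.
move=> hypM Mx; have [U [g [Ux eqg]]] := hypM x Mx.
have /dotmul_self_gt0 d_gt0 : grad g x != 0 by case: eqg => _ _ + _; exact.
set d := dotmul _ _ in d_gt0; exists ((Num.sqrt d)^-1 *: grad g x); split.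
  rewrite dotmulZ -/d exprVn sqr_sqrtr ?ltW //.
  by rewrite mulVf ?gt_eqF.
by exists U, g; split=> //; exists (Num.sqrt d)^-1.
Qed.

(** If [x + s *: v] lay on [M], it would also be the base point of a normal
    expression with parameter [0]; uniqueness in the tube identifies the two. *)
Lemma normal_segment_meets_surface_once (Omega M : set V) (rho : R) (x v : V)
    (s : R) :
  is_hypersurface (class_C 1) M -> tube_radius Omega M rho ->
  M x -> unit_normal M x v -> `|s| < rho -> M (x + s *: v) -> s = 0.
Proof.
move=> hypM [rho_gt0 tubeM] Mx nv s_lt My.
have [w nw] := unit_normal_exists hypM My.
have [_ [_ uniq_expr]] := tubeM x s v Mx nv s_lt.
have /uniq_expr expr_x : tube_expr M rho (x + s *: v) x s v by [].
have /expr_x[_] : tube_expr M rho (x + s *: v) (x + s *: v) 0 w.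
  by split=> //; rewrite ?normr0 // scale0r addr0.
by case=> -[-> _]; rewrite ?oppr0.
Qed.

End Normals.

Section Isle.
Context {R : realType} {n : nat}.
Local Notation V := 'rV[R]_n.+1.
Variables (Phi : R -> V -> V) (t r : R).
Hypothesis r_gt1 : 1 < r.

Lemma isle_ge0 (x : V) : 0 <= isle Phi t r x.
Proof. by rewrite /isle; case: ifP => // _; rewrite divr_ge0// ln_ge0// ltW. Qed.

(** A strict bound at the final time rules out every hitting time, since
    [lambda Phi] is largest at the end of the window. *)
Lemma isle_eq0 (y : V) :
  {in `[0, t] &, {homo (fun tau => lambda Phi tau y) : a b / a <= b}} ->
  lambda Phi t y < r ^+ 2 -> isle Phi t r y = 0.
Proof.
move=> incr lam_lt; rewrite /isle; case: asboolP => // -[tau [/andP[tau0 taut]]].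
move=> sqrt_lam; have lam_gt0 : 0 < lambda Phi tau y.
  by rewrite -sqrtr_gt0 sqrt_lam (lt_trans ltr01).
have : lambda Phi tau y <= lambda Phi t y.
  by apply: incr => //; rewrite in_itv /= ?tau0 ?taut ?lexx ?(le_trans tau0 taut).
move=> /le_lt_trans/(_ lam_lt).
by rewrite -sqrt_lam (sqr_sqrtr (ltW lam_gt0)) ltxx.
Qed.

End Isle.

Theorem theorem4p3 (R : realType) (n : nat) (Omega : set 'rV[R]_n.+1)
    (u : 'rV[R]_n.+1 -> R -> 'rV[R]_n.+1) (Phi : R -> 'rV[R]_n.+1 -> 'rV[R]_n.+1)
    (t : R) (M : set 'rV[R]_n.+1) (m rho : R)
    (domain_Omega : is_domain Omega)
    (lipschitz_u : [lipschitz u p.1 p.2 | p in Omega `*` [set: R]])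
    (t_gt0 : 0 < t)
    (flow_Phi : is_flow Omega u 0 t Phi)
    (diff_Phi : forall tau x, tau \in `[0, t] -> Omega x ->
       differentiable (Phi tau) x)
    (ridge_M : is_ridge Omega (lambda Phi t) M)
    (smooth_M : is_hypersurface class_Cinfty M)
    (m_min : [set Num.sqrt (lambda Phi t x) | x in M] m /\
             lbound [set Num.sqrt (lambda Phi t x) | x in M] m)
    (m_gt1 : 1 < m)
    (rho_tube : tube_radius Omega M rho)
    (lambda_incr : forall y, tube M rho y ->
       {in `[0, t] &, {homo (fun tau => lambda Phi tau y) : a b / a <= b}})
    (superlevel : [set x | tube M rho x /\ m ^+ 2 <= lambda Phi t x] = M) :
  is_ridge Omega (isle Phi t m) M.
Proof.
have [MOmega compactM hypM _] := ridge_M.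
split=> // x v Mx nv; have [rho_gt0 tubeM] := rho_tube.
exists rho; first exact: rho_gt0.
move=> s s_lt.
have [->|s_neq0] := eqVneq s 0; first by rewrite scale0r addr0 lexx.
have [_ tube_y] := tubeM x s v Mx nv s_lt.
rewrite (isle_eq0 m_gt1 (lambda_incr _ tube_y)); first exact: isle_ge0.
rewrite ltNge; apply: contra_neqN s_neq0 => lam_ge.
apply: (normal_segment_meets_surface_once hypM rho_tube Mx nv s_lt).
by rewrite -superlevel; split.
Qed.
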